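(* Let $X$ be the $C^*$-correspondence of a $C^*$-dynamical system $(A,\alpha)$. Then the algebra $\mathcal O(A,X)$ together with the mapping $k_A$ and the operator $u:=k_X(\alpha(1))^*$ forms a Stacey's crossed product for $(A,\alpha)$.
   Context: A $C^*$-dynamical system is a pair $(A,\alpha)$ where $A$ is a unital $C^*$-algebra and $\alpha:A\to A$ is a $*$-endomorphism (not assumed unital or injective). Stacey's crossed product for an endomorphism $\alpha$ of a unital $C^*$-algebra $A$ is a unital $C^*$-algebra $B$ (possibly zero) together with a unital $*$-homomorphism $i_A:A\to B$ and an isometry $u\in B$ such that: (i) $i_A(\alpha(a))=u\,i_A(a)u^*$ for all $a\in A$; (ii) $B$ is generated by $i_A(A)$ and $u$; (iii) for every non-degenerate representation $\pi:A\to L(H)$ and isometry $T\in L(H)$ with $\pi(\alpha(a))=T\pi(a)T^*$ for all $a\in A$, there is a representation $\pi\times T:B\to L(H)$ such that $(\pi\times T)\circ i_A=\pi$ and $(\pi\times T)(u)=T$. A $C^*$-correspondence $X$ over $A$ is a right Hilbert $A$-module with a $*$-homomorphism $\phi:A\to\mathcal L(X)$ into the adjointable operators; $a\cdot x:=\phi(a)x$. $\mathcal K(X)$ is the closed span of $\Theta_{x,y}(z)=x\langle y,z\rangle_A$, and $J(X)=\phi^{-1}(\mathcal K(X))$. A representation $(\pi,t,D)$ of $X$ in a $C^*$-algebra $D$ consists of a linear map $t:X\to D$ and a homomorphism $\pi:A\to D$ with $t(x\cdot a)=t(x)\pi(a)$, $t(x)^*t(y)=\pi(\langle x,y\rangle_A)$,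 $t(a\cdot x)=\pi(a)t(x)$. It induces a homomorphism $(\pi,t,D)^{(1)}:\mathcal K(X)\to D$, $\Theta_{x,y}\mapsto t(x)t(y)^*$. It is covariant on an ideal $J\subset J(X)$ if $(\pi,t,D)^{(1)}(\phi(a))=\pi(a)$ for all $a\in J$. The relative Cuntz–Pimsner algebra $\mathcal O(J,X)$ is the $C^*$-algebra generated by a representation $(k_A,k_X)$ of $X$ covariant on $J$ that is universal: every representation $(\pi,t)$ covariant on $J$ factors through a homomorphism of $\mathcal O(J,X)$ taking $k_A$ to $\pi$ and $k_X$ to $t$. The $C^*$-correspondence of $(A,\alpha)$ is $X=\alpha(1)A$ with $a\cdot x=\alpha(a)x$, $x\cdot a=xa$, $\langle x,y\rangle_A=x^*y$. Here $J(X)=A$, so $\mathcal O(A,X)$ (the case $J=A$) is defined. *)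

(* Defs.v *)
From HB Require Import structures.
From mathcomp Require Import all_boot all_order all_algebra.
From mathcomp Require Import complex.
From mathcomp Require Import boolp classical_sets reals topology normedtype.

Set Implicit Arguments.
Unset Strict Implicit.
Unset Printing Implicit Defensive.

Import Order.TTheory GRing.Theory Num.Theory.
Import numFieldNormedType.Exports.

Local Open Scope classical_set_scope.
Local Open Scope ring_scope.
Local Open Scope complex_scope.

(* The product is a separate field because a C*-algebra need not have a unit,
   whereas the library's ring structures include one; the zero algebra is
   allowed. *)
HB.mixin Record CompleteNormedModule_isCStar (R : realType) A
    & CompleteNormedModule R[i] A := {
  cmul : A -> A -> A;
  cstar : A -> A;
  cmulA : forall a b c, cmul a (cmul b c) = cmul (cmul a b) c;
  cmulDl : forall a b c, cmul (a + b) c = cmul a c + cmul b c;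
  cmulDr : forall a b c, cmul a (b + c) = cmul a b + cmul a c;
  cmulZl : forall (l : R[i]) a b, cmul (l *: a) b = l *: cmul a b;
  cmulZr : forall (l : R[i]) a b, cmul a (l *: b) = l *: cmul a b;
  cstarD : forall a b, cstar (a + b) = cstar a + cstar b;
  cstarZ : forall (l : R[i]) a, cstar (l *: a) = (Num.conj l) *: cstar a;
  cstarM : forall a b, cstar (cmul a b) = cmul (cstar b) (cstar a);
  cstarK : forall a, cstar (cstar a) = a;
  cnormM : forall a b, `|cmul a b| <= `|a| * `|b|;
  cnorm_star : forall a, `|cmul (cstar a) a| = `|a| ^+ 2
}.

#[short(type="cstarType")]
HB.structure Definition CStar (R : realType) :=
  {A of CompleteNormedModule_isCStar R A & CompleteNormedModule R[i] A}.

Notation "a ** b" := (cmul a b) (at level 40, left associativity).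

Definition is_unity (R : realType) (A : cstarType R) (e : A) : Prop :=
  forall a, e ** a = a /\ a ** e = a.

HB.mixin Record CStar_isUnital (R : realType) A & CStar R A := {
  cone : A;
  cone_unity : is_unity cone
}.

#[short(type="unitalCstarType")]
HB.structure Definition UnitalCStar (R : realType) :=
  {A of CStar_isUnital R A & CStar R A}.

Record starHom (R : realType) (A B : cstarType R) := StarHom {
  star_hom :> A -> B;
  star_homP : linear star_hom;
  star_homM : forall a b, star_hom (a ** b) = star_hom a ** star_hom b;
  star_homS : forall a, star_hom (cstar a) = cstar (star_hom a)
}.

Record is_cstar_subalg (R : realType) (A : cstarType R) (S : set A) : Prop := {
  subalg_closed : closed S;
  subalg0 : S 0;
  subalgD : forall a b, S a -> S b -> S (a + b);
  subalgZ : forall (l : R[i]) a, S a -> S (l *: a);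
  subalgM : forall a b, S a -> S b -> S (a ** b);
  subalgS : forall a, S a -> S (cstar a)
}.

Definition cstar_generated (R : realType) (A : cstarType R) (G : set A) :=
  forall S : set A, is_cstar_subalg S -> G `<=` S -> S = setT.

HB.mixin Record CompleteNormedModule_isHilbert (R : realType) H
    & CompleteNormedModule R[i] H := {
  hdot : {dot H for Num.conj};
  hdot_norm : forall x : H, `|x| ^+ 2 = hdot x x
}.

#[short(type="hilbertType")]
HB.structure Definition Hilbert (R : realType) :=
  {H of CompleteNormedModule_isHilbert R H & CompleteNormedModule R[i] H}.

Definition is_bounded_op (R : realType) (H : hilbertType R) (T : H -> H) :=
  linear T /\ continuous T.

Definition is_hadjoint (R : realType) (H : hilbertType R) (T Ts : H -> H) :=
  forall x y : H, hdot (T x) y = hdot x (Ts y).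

(* *-homomorphisms into the bounded operators on H, with rho (a^* ) = rho(a)^*
   spelled out through the inner product. *)
Record hilbertRep (R : realType) (A : cstarType R) (H : hilbertType R) :=
  HilbertRep {
  hrep :> A -> H -> H;
  hrep_bounded : forall a, is_bounded_op (hrep a);
  hrepP : forall (l : R[i]) a b x,
    hrep (l *: a + b) x = l *: hrep a x + hrep b x;
  hrepM : forall a b x, hrep (a ** b) x = hrep a (hrep b x);
  hrepS : forall a, is_hadjoint (hrep a) (hrep (cstar a))
}.

Definition nondegenerate (R : realType) (A : cstarType R) (H : hilbertType R)
    (pi : hilbertRep A H) : Prop :=
  closure [set v : H | exists n (a : 'I_n -> A) (x : 'I_n -> H),
                         v = \sum_(i < n) pi (a i) (x i)] = setT.

(* That iA(1) is a unit of B says both that B is unital and that iA is.  In the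
   universal property Ts is the adjoint of T, which exists and is unique for
   every bounded T, so that Ts (T x) = x says that T is an isometry. *)
Record is_stacey_crossed_product (R : realType) (A : unitalCstarType R)
    (alpha : starHom A A) (B : cstarType R) (iA : starHom A B) (u : B) : Prop :=
  {
  stacey_unital : is_unity (iA cone);
  stacey_isometry : cstar u ** u = iA cone;
  stacey_implements : forall a, iA (alpha a) = u ** iA a ** cstar u;
  stacey_generated : cstar_generated (range iA `|` [set u]);
  stacey_universal : forall (H : hilbertType R) (pi : hilbertRep A H)
      (T Ts : H -> H),
    nondegenerate pi ->
    is_bounded_op T -> is_hadjoint T Ts ->
    (forall x, Ts (T x) = x) ->
    (forall a x, pi (alpha a) x = T (pi a (Ts x))) ->
    exists rho : hilbertRep B H,
      (forall a, rho (iA a) =1 pi a) /\ rho u =1 T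
}.

(* An element of a C*-algebra is positive when it has the form b^* b.
   The norm of the underlying complete normed space is required to be the one
   coming from the A-valued inner product. *)
HB.mixin Record CompleteNormedModule_isHilbertModule (R : realType)
    (A : cstarType R) X & CompleteNormedModule R[i] X := {
  ract : X -> A -> X;
  hinner : X -> X -> A;
  ractDl : forall x y a, ract (x + y) a = ract x a + ract y a;
  ractDr : forall x a b, ract x (a + b) = ract x a + ract x b;
  ractZl : forall (l : R[i]) x a, ract (l *: x) a = l *: ract x a;
  ractZr : forall (l : R[i]) x a, ract x (l *: a) = l *: ract x a;
  ractM : forall x a b, ract x (a ** b) = ract (ract x a) b;
  hinnerD : forall x y z, hinner x (y + z) = hinner x y + hinner x z;
  hinnerZ : forall (l : R[i]) x y, hinner x (l *: y) = l *: hinner x y;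
  hinner_ract : forall x y a, hinner x (ract y a) = hinner x y ** a;
  hinner_star : forall x y, cstar (hinner x y) = hinner y x;
  hinner_pos : forall x, exists b, hinner x x = cstar b ** b;
  hinner_norm : forall x, `|x| ^+ 2 = `|hinner x x|
}.

#[short(type="hilbertModType")]
HB.structure Definition HilbertModule (R : realType) (A : cstarType R) :=
  {X of CompleteNormedModule_isHilbertModule R A X
      & CompleteNormedModule R[i] X}.

(* lact is phi : A -> L(X) in curried form; adjointability of phi(a) is part of
   lact_adjoint, and forces phi(a) to be A-linear and bounded. *)
HB.mixin Record HilbertModule_isCorrespondence (R : realType)
    (A : cstarType R) X & HilbertModule R A X := {
  lact : A -> X -> X;
  lactP : forall (l : R[i]) a b x, lact (l *: a + b) x = l *: lact a x + lact b x;
  lactM : forall a b x, lact (a ** b) x = lact a (lact b x);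
  lact_adjoint : forall a x y, hinner (lact a x) y = hinner x (lact (cstar a) y)
}.

#[short(type="correspondenceType")]
HB.structure Definition Correspondence (R : realType) (A : cstarType R) :=
  {X of HilbertModule_isCorrespondence R A X & HilbertModule R A X}.

Section CompactOperators.
Variables (R : realType) (A : cstarType R) (X : hilbertModType A).

Definition is_adjoint (S Ss : X -> X) : Prop :=
  forall x y, hinner (S x) y = hinner x (Ss y).

Definition adjointable (S : X -> X) : Prop := exists Ss, is_adjoint S Ss.

Definition rank_one (x y : X) : X -> X := fun z => ract x (hinner y z).

(* Operator-norm limits of finite sums of the Theta_{x,y}; scalars are absorbed
   in x. *)
Definition compact_op (S : X -> X) : Prop :=
  adjointable S /\
  forall e : R[i], 0 < e -> exists n (x y : 'I_n -> X),
    forall z, `|S z - \sum_(i < n) rank_one (x i) (y i) z| <= e * `|z|.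

End CompactOperators.

Section CuntzPimsner.
Variables (R : realType) (A : cstarType R) (X : correspondenceType A).

Definition J_of : set A := [set a | compact_op (lact a : X -> X)].

Record covIdeal := CovIdeal {
  cov_set :> set A;
  cov_closed : closed cov_set;
  cov0 : cov_set 0;
  covP : forall (l : R[i]) a b,
    cov_set a -> cov_set b -> cov_set (l *: a + b);
  cov_mull : forall a b, cov_set b -> cov_set (a ** b);
  cov_mulr : forall a b, cov_set a -> cov_set (a ** b);
  cov_sub : cov_set `<=` J_of
}.

Record corrRep (D : cstarType R) := CorrRep {
  crep_hom : starHom A D;
  crep_lin : X -> D;
  crep_linP : linear crep_lin;
  crep_ract : forall x a, crep_lin (ract x a) = crep_lin x ** crep_hom a;
  crep_inner : forall x y,
    cstar (crep_lin x) ** crep_lin y = crep_hom (hinner x y);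
  crep_lact : forall a x, crep_lin (lact a x) = crep_hom a ** crep_lin x
}.

(* Psi is the *-homomorphism K(X) -> D induced by k; its values off K(X) are
   irrelevant, and on K(X) it is unique, since *-homomorphisms between
   C*-algebras are contractive. *)
Record is_induced_hom (D : cstarType R) (k : corrRep D)
    (Psi : (X -> X) -> D) : Prop := {
  induced_theta : forall x y,
    Psi (rank_one x y) = crep_lin k x ** cstar (crep_lin k y);
  induced_linear : forall (l : R[i]) S T, compact_op S -> compact_op T ->
    Psi (fun x => l *: S x + T x) = l *: Psi S + Psi T;
  induced_mul : forall S T, compact_op S -> compact_op T ->
    Psi (S \o T) = Psi S ** Psi T;
  induced_star : forall S Ss, compact_op S -> is_adjoint S Ss ->
    Psi Ss = cstar (Psi S)
}.

Definition covariant_on (J : covIdeal) (D : cstarType R) (k : corrRep D) : Prop :=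
  exists Psi, is_induced_hom k Psi /\
    forall a, cov_set J a -> Psi (lact a) = crep_hom k a.

Record is_relative_cuntz_pimsner (J : covIdeal) (O : cstarType R)
    (k : corrRep O) : Prop := {
  rcp_covariant : covariant_on J k;
  rcp_generated : cstar_generated (range (crep_hom k) `|` range (crep_lin k));
  rcp_universal : forall (D : cstarType R) (t : corrRep D), covariant_on J t ->
    exists rho : starHom O D,
      (forall a, rho (crep_hom k a) = crep_hom t a) /\
      (forall x, rho (crep_lin k x) = crep_lin t x)
}.

End CuntzPimsner.

(* alpha(1)A *)
Definition corr_mem (R : realType) (A : unitalCstarType R)
    (alpha : starHom A A) : {pred A} :=
  [pred x | `[< exists a, x = alpha cone ** a >]].

Record corr (R : realType) (A : unitalCstarType R) (alpha : starHom A A) :=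
  Corr { corr_val : A; corr_valP : corr_val \in corr_mem alpha }.

Section DynamicalSystem.
Variables (R : realType) (A : unitalCstarType R) (alpha : starHom A A).

HB.instance Definition _ := [isSub for @corr_val R A alpha].
HB.instance Definition _ := [Choice of corr alpha by <:].

Let cone1l a : (cone : A) ** a = a. Proof. by case: (@cone_unity R A a). Qed.
Let cone1r a : a ** (cone : A) = a. Proof. by case: (@cone_unity R A a). Qed.
Let cone_star : cstar (cone : A) = cone.
Proof. by rewrite -[LHS]cone1r -{2}(cstarK cone) -cstarM cone1r cstarK. Qed.

Lemma corr_memP x : reflect (alpha cone ** x = x) (x \in corr_mem alpha).
Proof.
apply: (iffP (asboolP _)) => [[a ->]|xE]; last by exists x.
by rewrite cmulA -star_homM cone1l.
Qed.

Fact corr_submod_closed : submod_closed (corr_mem alpha).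
Proof.
split=> [|l x y /corr_memP xE /corr_memP yE]; apply/corr_memP.
  by rewrite -(scale0r 0) cmulZr !scale0r.
by rewrite cmulDr cmulZr xE yE.
Qed.
HB.instance Definition _ :=
  GRing.isSubmodClosed.Build R[i] A (corr_mem alpha) corr_submod_closed.
HB.instance Definition _ := [SubChoice_isSubLmodule of corr alpha by <:].

Local Notation X := (corr alpha).

Let norm (x : X) : R[i] := `|val x|.
Let normD x y : norm (x + y) <= norm x + norm y.
Proof. by rewrite /norm raddfD ler_normD. Qed.
Let normZ (l : R[i]) x : norm (l *: x) = `|l| * norm x.
Proof. by rewrite /norm linearZ normrZ. Qed.
Let norm0 x : norm x = 0 -> x = 0.
Proof. by move/eqP; rewrite normr_eq0 -(raddf0 (val : X -> A)) => /eqP/val_inj. Qed.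
HB.instance Definition _ := Lmodule_isNormed.Build R[i] X normD normZ norm0.

Lemma corr_valD (x y : X) : corr_val (x + y) = corr_val x + corr_val y.
Proof. exact: (raddfD (val : X -> A)). Qed.
Lemma corr_valZ (l : R[i]) (x : X) : corr_val (l *: x) = l *: corr_val x.
Proof. by rewrite -[corr_val (_ *: _)]/(val _) linearZ. Qed.
Lemma corr_normE (x : X) : `|x| = `|val x|. Proof. by []. Qed.

Fact corr_complete (F : set_system X) : ProperFilter F -> cauchy F -> cvg F.
Proof.
move=> FF /cauchy_ballP Fc.
have Gc : cauchy ((val : X -> A) @ F).
  apply/cauchy_ballP => e e0.
  have [[B1 B2] /= [FB1 FB2] sub] := Fc _ e0.
  exists ([set y | exists2 x, B1 x & y = val x],
          [set y | exists2 x, B2 x & y = val x]) => /=.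
    split; [apply: filterS FB1|apply: filterS FB2] => x Bx; by exists x.
  move=> [_ _] /= [[x Bx ->] [y By ->]].
  have := sub (x, y) (conj Bx By); rewrite -!ball_normE /=.
  by rewrite corr_normE raddfB.
have /cvg_ex [l Fl0] : cvg ((val : X -> A) @ F) by apply: cauchy_cvg Gc.
have /cvgrPdist_lt Fl := Fl0.
have lX : l \in corr_mem alpha.
  apply/corr_memP/eqP; rewrite -subr_eq0 -normr_eq0; apply/eqP.
  set p := alpha cone; apply: contrapT => /eqP N0.
  have Np : 0 < `|p ** l - l| by rewrite lt_def N0 normr_ge0.
  have P0 : 0 < `|p| + 1 by rewrite ltr_wpDl.
  have [x lx] := filter_ex (Fl _ (divr_gt0 Np P0)).
  have xE : p ** val x = val x by apply/corr_memP/valP.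
  have E : p ** l - l = p ** (l - val x) - (l - val x).
    have -> : p ** (l - val x) = p ** l - val x.
      by rewrite cmulDr -[- val x]scaleN1r cmulZr xE scaleN1r.
    by rewrite opprB addrA subrK.
  suff : `|p ** l - l| < `|p ** l - l| by rewrite ltxx.
  rewrite {1}E (le_lt_trans (ler_normB _ _))//.
  rewrite (le_lt_trans (lerD (cnormM _ _) (lexx _)))//.
  by rewrite -[X in _ + X]mul1r -mulrDl mulrC -ltr_pdivlMr.
apply/cvg_ex; exists (Corr lX); apply/cvgrPdist_lt => e /Fl.
by apply: filterS => x; rewrite corr_normE raddfB.
Qed.
HB.instance Definition _ := Uniform_isComplete.Build X corr_complete.

Fact corr_ract_subproof (x : X) a : val x ** a \in corr_mem alpha.
Proof. by apply/corr_memP; rewrite cmulA (elimT (corr_memP _) (valP x)). Qed.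

Fact corr_lact_subproof a (x : X) : alpha a ** val x \in corr_mem alpha.
Proof. by apply/corr_memP; rewrite cmulA -star_homM cone1l. Qed.

Definition corr_ract (x : X) a : X := Corr (corr_ract_subproof x a).
Definition corr_inner (x y : X) : A := cstar (val x) ** val y.
Definition corr_lact a (x : X) : X := Corr (corr_lact_subproof a x).

Fact corr_ractDl x y a : corr_ract (x + y) a = corr_ract x a + corr_ract y a.
Proof. by apply: val_inj; rewrite /= ?corr_valD cmulDl. Qed.
Fact corr_ractDr x a b : corr_ract x (a + b) = corr_ract x a + corr_ract x b.
Proof. by apply: val_inj; rewrite /= ?corr_valD cmulDr. Qed.
Fact corr_ractZl (l : R[i]) x a : corr_ract (l *: x) a = l *: corr_ract x a.
Proof. by apply: val_inj; rewrite /= ?corr_valZ cmulZl. Qed.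
Fact corr_ractZr (l : R[i]) x a : corr_ract x (l *: a) = l *: corr_ract x a.
Proof. by apply: val_inj; rewrite /= ?corr_valZ cmulZr. Qed.
Fact corr_ractM x a b : corr_ract x (a ** b) = corr_ract (corr_ract x a) b.
Proof. by apply: val_inj; rewrite /= cmulA. Qed.
Fact corr_innerD x y z :
  corr_inner x (y + z) = corr_inner x y + corr_inner x z.
Proof. by rewrite /corr_inner /= cmulDr. Qed.
Fact corr_innerZ (l : R[i]) x y : corr_inner x (l *: y) = l *: corr_inner x y.
Proof. by rewrite /corr_inner /= cmulZr. Qed.
Fact corr_inner_ract x y a :
  corr_inner x (corr_ract y a) = corr_inner x y ** a.
Proof. by rewrite /corr_inner /= cmulA. Qed.
Fact corr_inner_star x y : cstar (corr_inner x y) = corr_inner y x.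
Proof. by rewrite /corr_inner cstarM cstarK. Qed.
Fact corr_inner_pos x : exists b, corr_inner x x = cstar b ** b.
Proof. by exists (val x). Qed.
Fact corr_inner_norm (x : X) : `|x| ^+ 2 = `|corr_inner x x|.
Proof. by rewrite corr_normE -cnorm_star. Qed.
HB.instance Definition _ := CompleteNormedModule_isHilbertModule.Build R A X
  corr_ractDl corr_ractDr corr_ractZl corr_ractZr corr_ractM
  corr_innerD corr_innerZ corr_inner_ract corr_inner_star corr_inner_pos
  corr_inner_norm.

Fact corr_lactP (l : R[i]) a b x :
  corr_lact (l *: a + b) x = l *: corr_lact a x + corr_lact b x.
Proof.
by apply: val_inj; rewrite /= (star_homP alpha) cmulDl cmulZl.
Qed.
Fact corr_lactM a b x : corr_lact (a ** b) x = corr_lact a (corr_lact b x).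
Proof. by apply: val_inj; rewrite /= star_homM cmulA. Qed.
Fact corr_lact_adjoint a (x y : X) :
  hinner (corr_lact a x) y = hinner x (corr_lact (cstar a) y).
Proof.
by rewrite /hinner /= /corr_inner /= cstarM star_homS cmulA.
Qed.
HB.instance Definition _ := HilbertModule_isCorrespondence.Build R A X
  corr_lactP corr_lactM corr_lact_adjoint.

Fact corr_gen_subproof : alpha cone \in corr_mem alpha.
Proof. by apply/corr_memP; rewrite -star_homM cone1l. Qed.

(* alpha(1) as an element of X *)
Definition corr_gen : X := Corr corr_gen_subproof.

Lemma corr_J : J_of X = setT.
Proof.
rewrite -subTset => a _; split.
  by exists (lact (cstar a)) => x y; apply: lact_adjoint.
move=> e e0; exists 1%N, (fun=> lact a corr_gen), (fun=> corr_gen) => z.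
rewrite big_ord1 [X in `|X|](_ : _ = 0) ?normr0 ?mulr_ge0 ?normr_ge0 ?ltW//.
apply/eqP; rewrite subr_eq0; apply/eqP/val_inj => /=.
rewrite /hinner /= /corr_inner /= -star_homS cone_star !cmulA -!star_homM.
by rewrite !cone1r.
Qed.

Fact full_ideal_sub : setT `<=` J_of X. Proof. by rewrite corr_J. Qed.

(* J = A *)
Definition full_ideal : covIdeal X :=
  @CovIdeal R A X setT closedT I (fun _ _ _ _ _ => I) (fun _ _ _ => I)
    (fun _ _ _ => I) full_ideal_sub.

End DynamicalSystem.

(* Main.v *)
Require Import Defs.
From HB Require Import structures.
From mathcomp Require Import all_boot all_order all_algebra.
From mathcomp Require Import complex ring.
From mathcomp Require Import boolp classical_sets functions reals topology.
From mathcomp Require Import normedtype.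

(** Write p = alpha(1), let g = p as an element of X, and let (k, t) be a
    representation of X, v = t(g).  As x = g x for x in X, t(x) = v k(x), so
    v^* v = k(p), k(a) v = v k(alpha(a)) and v^* k(a) v = k(alpha(a)).  Since
    phi(a) = Theta_{a g, g}, covariance on A says exactly that v v^* = k(1),
    i.e. that u = v^* is an isometry.  Conversely a pair (pi, T) as in the
    universal property of Stacey's crossed product gives the representation
    (pi, x |-> T^* pi(x)) in the C*-algebra of bounded adjointable operators on
    H; it satisfies v v^* = T^* T = 1, hence is covariant and factors through
    O(A, X). *)

Set Implicit Arguments.
Unset Strict Implicit.
Unset Printing Implicit Defensive.

Import Order.TTheory GRing.Theory Num.Theory.
Import numFieldNormedType.Exports.

Local Open Scope classical_set_scope.
Local Open Scope ring_scope.

(** * The unit of a unital C*-algebra *)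

Section UnitalCStarTheory.
Variables (R : realType) (A : unitalCstarType R).

Lemma cone_mull (a : A) : cone ** a = a.
Proof. by case: (@cone_unity R A a). Qed.

Lemma cone_mulr (a : A) : a ** cone = a.
Proof. by case: (@cone_unity R A a). Qed.

Lemma cstar_cone : cstar (cone : A) = cone.
Proof.
by rewrite -[LHS]cone_mulr -{2}(cstarK cone) -cstarM cone_mulr cstarK.
Qed.

End UnitalCStarTheory.

(** * Adjointable maps on Hilbert modules *)

Section HilbertModuleTheory.
Variables (R : realType) (A : cstarType R) (X : hilbertModType A).

Lemma hinner_inj (x y : X) : (forall z, hinner z x = hinner z y) -> x = y.
Proof.
move=> xy; apply/eqP; rewrite -subr_eq0 -normr_eq0 -sqrf_eq0 hinner_norm.
by rewrite hinnerD -(scaleN1r y) hinnerZ xy !scaleN1r subrr normr0.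
Qed.

(** An adjoint forces [A]-linearity: both sides have the same inner product with every [z] once [S]
    is moved across as [Ss], and inner products separate points. *)
Lemma adjointable_ract (S : X -> X) x a :
  adjointable S -> S (ract x a) = ract (S x) a.
Proof.
move=> [Ss SSs]; apply: hinner_inj => z.
have adj y : hinner z (S y) = hinner (Ss z) y.
  by rewrite -hinner_star SSs hinner_star.
by rewrite hinner_ract !adj hinner_ract.
Qed.

End HilbertModuleTheory.

(** * The correspondence of a dynamical system and its representations *)

Section CorrTheory.
Variables (R : realType) (A : unitalCstarType R) (alpha : starHom A A).
Local Notation X := (corr alpha).
Local Notation g := (corr_gen alpha).
Local Notation p := (alpha cone).

Lemma corr_val_ract (x : X) a : corr_val (ract x a) = corr_val x ** a.
Proof. by []. Qed.

Lemma corr_val_lact (x : X) a : corr_val (lact a x) = alpha a ** corr_val x.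
Proof. by []. Qed.

Lemma hinner_corrE (x y : X) :
  hinner x y = cstar (corr_val x) ** corr_val y.
Proof. by []. Qed.

Lemma cproj_mul a : p ** alpha a = alpha a.
Proof. by rewrite -star_homM cone_mull. Qed.

Lemma mul_cproj a : alpha a ** p = alpha a.
Proof. by rewrite -star_homM cone_mulr. Qed.

Lemma cstar_cproj : cstar p = p.
Proof. by rewrite -star_homS cstar_cone. Qed.

Lemma cproj_val (x : X) : p ** corr_val x = corr_val x.
Proof. exact: (corr_memP alpha _ (valP x)). Qed.

Lemma corr_genE (x : X) : ract g (corr_val x) = x.
Proof. by apply: val_inj; rewrite /= cproj_val. Qed.

Lemma lact_genE a (x : X) : lact a x = rank_one (lact a g) g x.
Proof.
by apply: val_inj => /=; rewrite hinner_corrE /= cstar_cproj cproj_val mul_cproj.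
Qed.

Variables (D : cstarType R) (t : corrRep X D).
Local Notation k := (crep_hom t).
Local Notation v := (crep_lin t g).

Lemma crep_linE x : crep_lin t x = v ** k (corr_val x).
Proof. by rewrite -crep_ract corr_genE. Qed.

Lemma crep_gen_innerE : cstar v ** v = k p.
Proof. by rewrite crep_inner hinner_corrE /= cstar_cproj mul_cproj. Qed.

Lemma crep_gen_proj : v ** k p = v.
Proof. by rewrite [RHS]crep_linE. Qed.

Lemma crep_gen_partial_isometry : v ** cstar v ** v = v.
Proof. by rewrite -cmulA crep_gen_innerE crep_gen_proj. Qed.

Lemma crep_gen_comm a : k a ** v = v ** k (alpha a).
Proof. by rewrite -crep_lact crep_linE corr_val_lact /= mul_cproj. Qed.

Lemma crep_gen_implements a : cstar v ** k a ** v = k (alpha a).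
Proof.
by rewrite -cmulA crep_gen_comm cmulA crep_gen_innerE -star_homM cproj_mul.
Qed.

(** [v v^*] is a left unit on the image of [X]. The adjoint form [t(y)^* v v^* = t(y)^*] gives the
    value of [corr_induced] on rank-one operators. *)
Lemma crep_gen_rangeproj x : v ** cstar v ** crep_lin t x = crep_lin t x.
Proof. by rewrite (crep_linE x) cmulA crep_gen_partial_isometry. Qed.

(* Every adjointable S is Theta_{S g, g}, hence its image is forced. *)
Definition corr_induced (S : X -> X) : D := crep_lin t (S g) ** cstar v.

Lemma corr_induced_hom : is_induced_hom t corr_induced.
Proof.
split=> [x y|l S T _ _|S T [Sadj _] _|S Ss _ SSs]; rewrite /corr_induced.
- have -> : rank_one x y g = ract x (hinner y g) by [].
  rewrite crep_ract -crep_inner -!cmulA; congr (_ ** _).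
  by have := congr1 (@cstar R D) (crep_gen_rangeproj y); rewrite !cstarM cstarK.
- by rewrite crep_linP cmulDl cmulZl.
(* [T g = g b], where [b] is [T g] read in [A], and [S] is [A]-linear. *)
- have -> : (S \o T) g = ract (S g) (corr_val (T g)).
    by rewrite -(adjointable_ract _ _ Sadj) corr_genE.
  rewrite crep_ract [in RHS]cmulA -(cmulA _ (cstar v)) crep_inner.
  by rewrite hinner_corrE /= cstar_cproj cproj_val.
(* Pairing with [g] determines the adjoint at [g]: read in [A], [Ss g] is [(S g)^* p]. *)
- have := SSs g g; rewrite !hinner_corrE /= cstar_cproj cproj_val => SsE.
  have kpv : k p ** cstar v = cstar v.
    by rewrite -{1}cstar_cproj star_homS -cstarM crep_gen_proj.
  rewrite (crep_linE (Ss g)) -SsE (crep_linE (S g)) star_homM star_homS.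
  by rewrite !cstarM cstarK -!cmulA kpv.
Qed.

(** Covariance at the unit already gives the equation, because [phi(1) = Theta_{g,g}]. Conversely,
    [corr_induced] sends [phi(a)] to [k(a) v v^* = k(a) k(1) = k(a)]. *)
Lemma covariant_onP :
  covariant_on (full_ideal alpha) t <-> v ** cstar v = k cone.
Proof.
split=> [[Psi [hPsi PsiE]]|vvE].
  have gE : lact cone g = g by apply: val_inj; rewrite /= mul_cproj.
  rewrite -PsiE // -(induced_theta hPsi); congr Psi.
  by apply/funext => x; rewrite lact_genE gE.
exists corr_induced; split=> [|a _]; first exact: corr_induced_hom.
by rewrite /corr_induced crep_lact -cmulA vvE -star_homM cone_mulr.
Qed.

End CorrTheory.

(** * Inner products, adjoints and operator norms on a Hilbert space *)

Section HilbertTheory.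
Variables (R : realType) (H : hilbertType R).
Implicit Types (x y : H) (T S : H -> H).

Lemma hdotC x y : hdot x y = (hdot y x)^*.
Proof. by rewrite hermC expr0 mul1r. Qed.

Lemma hdot_inj x y : (forall z, hdot z x = hdot z y) -> x = y.
Proof.
move=> xy; apply/eqP; rewrite -subr_eq0 -normr_eq0 -sqrf_eq0 hdot_norm.
by rewrite linearBr /= xy subrr.
Qed.

Lemma cauchy_schwarz_hdot x y : `|hdot x y| <= `|x| * `|y|.
Proof.
have [->|y0] := eqVneq y 0; first by rewrite linear0r !normr0 mulr0.
have y_gt0 : 0 < `|y| ^+ 2 by rewrite exprn_gt0 ?normr_gt0.
rewrite -ler_sqr ?nnegrE ?mulr_ge0 // exprMn -(ler_pM2l y_gt0).
(* [z] is [|y|^2] times the component of [x] orthogonal to [y]; the scaling avoids a division. *)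
pose z := `|y| ^+ 2 *: x - hdot x y *: y.
have : 0 <= hdot z z by rewrite -hdot_norm exprn_ge0.
have -> : hdot z z = `|y| ^+ 2 * (`|y| ^+ 2 * `|x| ^+ 2 - `|hdot x y| ^+ 2).
  rewrite /z !(linearBl, linearBr) /= !(linearZl_LR, linearZr_LR) /=.
  by rewrite -!hdot_norm geC0_conj ?ltW // (hdotC y x) normCK; ring.
by rewrite mulrBr subr_ge0 [`|x| ^+ 2 * _]mulrC.
Qed.

Lemma is_hadjoint_sym T S : is_hadjoint T S -> is_hadjoint S T.
Proof. by move=> TS x y; rewrite hdotC -TS -hdotC. Qed.

Lemma is_hadjoint_uniq T S S' : is_hadjoint T S -> is_hadjoint T S' -> S = S'.
Proof.
by move=> TS TS'; apply/funext => y; apply: hdot_inj => z; rewrite -TS TS'.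
Qed.

Lemma is_hadjoint_linear T S : is_hadjoint T S -> linear S.
Proof.
move=> TS l x y; apply: hdot_inj => z.
by rewrite -TS !linearDr /= !linearZr_LR /= !TS.
Qed.

Definition op_bound T (M : R[i]) := 0 <= M /\ forall x, `|T x| <= M * `|x|.

(* |S y|^2 = <T S y, y> <= M |S y| |y| *)
Lemma op_bound_adjoint T S M : is_hadjoint T S -> op_bound T M -> op_bound S M.
Proof.
move=> TS [M0 TM]; split=> // y.
have [->|Sy0] := eqVneq (S y) 0; first by rewrite normr0 mulr_ge0.
have Sy_gt0 : 0 < `|S y| by rewrite normr_gt0.
rewrite -(ler_pM2l Sy_gt0) -expr2 hdot_norm -TS.
rewrite -[hdot _ _]ger0_norm; last by rewrite TS -hdot_norm exprn_ge0.
rewrite (le_trans (cauchy_schwarz_hdot _ _)) //.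
by rewrite mulrCA mulrA ler_wpM2r.
Qed.

Lemma is_bounded_opP T : is_bounded_op T <-> linear T /\ exists M, op_bound T M.
Proof.
split=> [[Tlin Tc]|[Tlin [M [M0 TM]]]]; split=> //.
  pose f : {linear H -> H} := HB.pack T (GRing.isLinear.Build _ _ _ _ T Tlin).
  have /linear_boundedP : bounded_near f (nbhs (0 : H)).
    exact/linear_bounded_continuous.
  (* The estimate holds for every constant above the real number [M]; [|M| + 1] is one, and it is
     nonnegative. *)
  move=> [M [Mr TM]]; exists (`|M| + 1); split=> [|x]; first by rewrite addr_ge0.
  apply: TM; rewrite (le_lt_trans (real_ler_norm _)) // ltrDl//.
pose f : {linear H -> H} := HB.pack T (GRing.isLinear.Build _ _ _ _ T Tlin).
apply/(linear_bounded_continuous f)/linear_boundedP.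
near=> r => x; rewrite (le_trans (TM x)) // ler_wpM2r //.
near: r. apply: nbhs_pinfty_ge. exact: ger0_real.
Unshelve. all: by end_near. Qed.

(** Bounds are cut down to [R], where an infimum makes sense. Since a bound in [R[i]] is
    nonnegative, hence real, none is lost. *)
Let op_bounds T := [set r : R | op_bound T (r%:C)%C].

(* The infimum of the empty set is 0, so opnorm T = 0 when T is unbounded. *)
Definition opnorm T : R[i] := ((inf (op_bounds T))%:C)%C.

Let op_bounds_lb T : lbound (op_bounds T) 0.
Proof. by move=> r [] ; rewrite ler0c. Qed.

Lemma opnorm_ge0 T : 0 <= opnorm T.
Proof.
rewrite ler0c; have [->|/set0P T0] := eqVneq (op_bounds T) set0.
  by rewrite inf0.
exact: lb_le_inf T0 (@op_bounds_lb T).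
Qed.

Let op_boundC T M : op_bound T M -> op_bounds T (complex.Re M).
Proof. by move=> /[dup] TM [M0 _]; rewrite /op_bounds /= RRe_real ?ger0_real. Qed.

Lemma opnorm_min T M : op_bound T M -> opnorm T <= M.
Proof.
move=> /[dup] TM [M0 _]; rewrite -[M]RRe_real ?ger0_real // lecR.
by apply: ge_inf; [exists 0; exact: op_bounds_lb|exact: op_boundC].
Qed.

(** The infimum is itself a bound: for [x] nonzero, [|T x| / |x|] lies below every bound, hence
    below their infimum. *)
Lemma opnormP T M : op_bound T M -> op_bound T (opnorm T).
Proof.
move=> TM; split=> [|x]; first exact: opnorm_ge0.
have [x0|x0] := eqVneq `|x| 0.
  by rewrite x0 mulr0; case: TM => _ /(_ x); rewrite x0 mulr0.
have x_gt0 : 0 < `|x| by rewrite lt_def x0 normr_ge0.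
rewrite -ler_pdivrMr // -[_ / _]RRe_real ?ger0_real ?divr_ge0 // lecR.
apply: lb_le_inf; first by exists (complex.Re M); exact: op_boundC.
move=> r [_ /(_ x)]; rewrite -ler_pdivrMr // -lecR RRe_real //.
by rewrite ger0_real ?divr_ge0.
Qed.

End HilbertTheory.

(** * The C*-algebra of bounded adjointable operators *)

Section BoundedOperators.
Variables (R : realType) (H : hilbertType R).
Implicit Types (f g : H -> H) (x y : H).

(* Asking for the adjoint makes the Riesz representation theorem unnecessary. *)
Definition is_bop f :=
  [/\ linear f, exists M, op_bound f M & exists fs, is_hadjoint f fs].

Definition bop_mem : {pred H -> H} := [pred f | `[< is_bop f >]].

Record bop := BOp { bop_val : H -> H; bop_valP : bop_val \in bop_mem }.

HB.instance Definition _ := [isSub for bop_val].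
HB.instance Definition _ := [Choice of bop by <:].

Lemma bop_memP f : reflect (is_bop f) (f \in bop_mem).
Proof. exact: asboolP. Qed.

Lemma op_boundD f g M N : op_bound f M -> op_bound g N ->
  op_bound (f + g) (M + N).
Proof.
move=> [M0 fM] [N0 gN]; split=> [|x]; first exact: addr_ge0.
by rewrite mulrDl (le_trans (ler_normD _ _)) // lerD.
Qed.

Lemma op_boundZ f M (l : R[i]) : op_bound f M -> op_bound (l *: f) (`|l| * M).
Proof.
move=> [M0 fM]; split=> [|x]; first exact: mulr_ge0.
by rewrite normrZ -mulrA ler_wpM2l.
Qed.

Lemma op_bound_comp f g M N : op_bound f M -> op_bound g N ->
  op_bound (f \o g) (M * N).
Proof.
move=> [M0 fM] [N0 gN]; split=> [|x /=]; first exact: mulr_ge0.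
by rewrite (le_trans (fM _)) // -mulrA ler_wpM2l.
Qed.

Fact bop_submod_closed : submod_closed bop_mem.
Proof.
split=> [|l f g /bop_memP[flin [M fM] [fs ffs]] /bop_memP[glin [N gN] [gs ggs]]].
  apply/bop_memP; split=> [l x y||]; first by rewrite scaler0 addr0.
    by exists 0; split=> // x; rewrite normr0 mul0r.
  by exists 0 => x y; rewrite linear0l linear0r.
apply/bop_memP; split.
- move=> m x y; rewrite !fctE flin glin !scalerDr !scalerA mulrC.
  by rewrite -!addrA; congr (_ + _); rewrite addrCA.
- by exists (`|l| * M + N); apply: op_boundD => //; exact: op_boundZ.
- exists (l^* *: fs + gs) => x y.
  rewrite !fctE !(linearDl, linearDr) /= linearZl_LR linearZr_LR /= conjCK.
  by rewrite ffs ggs.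
Qed.
HB.instance Definition _ :=
  GRing.isSubmodClosed.Build R[i] (H -> H) bop_mem bop_submod_closed.
HB.instance Definition _ := [SubChoice_isSubLmodule of bop by <:].

Implicit Types S T : bop.

Lemma bop_linear T : linear (bop_val T).
Proof. by have /bop_memP[] := bop_valP T. Qed.

Lemma bop_bound T : op_bound (bop_val T) (opnorm (bop_val T)).
Proof. by have /bop_memP[_ [M TM] _] := bop_valP T; exact: opnormP TM. Qed.

Lemma bop_adjoint T : exists Ts, is_hadjoint (bop_val T) Ts.
Proof. by have /bop_memP[] := bop_valP T. Qed.

Lemma bop_valD S T : bop_val (S + T) = bop_val S + bop_val T.
Proof. exact: (raddfD (val : bop -> (H -> H))). Qed.

Lemma bop_valZ (l : R[i]) T : bop_val (l *: T) = l *: bop_val T.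
Proof. by rewrite -[bop_val (_ *: _)]/(val _) linearZ. Qed.

Lemma bop_val0 : bop_val 0 = 0.
Proof. exact: (raddf0 (val : bop -> (H -> H))). Qed.

Let norm T : R[i] := opnorm (bop_val T).

Let normD S T : norm (S + T) <= norm S + norm T.
Proof.
rewrite /norm bop_valD; apply: opnorm_min; apply: op_boundD; exact: bop_bound.
Qed.

Let normZ_le (l : R[i]) T : norm (l *: T) <= `|l| * norm T.
Proof.
by rewrite /norm bop_valZ; apply: opnorm_min; apply: op_boundZ; exact: bop_bound.
Qed.

Let norm_eq0 T : norm T = 0 -> T = 0.
Proof.
move=> T0; apply: val_inj; rewrite -[RHS]/(bop_val 0) bop_val0; apply/funext => x.
have [_ /(_ x)] := bop_bound T; rewrite -/(norm T) T0 mul0r normr_le0.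
by move=> /eqP.
Qed.

Let normZ (l : R[i]) T : norm (l *: T) = `|l| * norm T.
Proof.
apply/eqP; rewrite eq_le normZ_le /=.
have [->|l0] := eqVneq l 0; first by rewrite normr0 mul0r opnorm_ge0.
(* The reverse inequality is [normZ_le] applied to [l^-1] and [l *: T]. *)
rewrite -{1}[T](scalerK l0) -ler_pdivlMl ?normr_gt0 // -normfV.
exact: normZ_le.
Qed.

HB.instance Definition _ := Lmodule_isNormed.Build R[i] bop normD normZ norm_eq0.

Lemma bop_normP T x : `|bop_val T x| <= `|T| * `|x|.
Proof. by have [_] := bop_bound T. Qed.

Lemma bop_norm_min T M : op_bound (bop_val T) M -> `|T| <= M.
Proof. exact: opnorm_min. Qed.

Definition bop_adj T : H -> H := projT1 (cid (bop_adjoint T)).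

Lemma bop_adjP T : is_hadjoint (bop_val T) (bop_adj T).
Proof. by rewrite /bop_adj; case: cid. Qed.

Fact bop_star_subproof T : bop_adj T \in bop_mem.
Proof.
apply/bop_memP; split; first exact: is_hadjoint_linear (bop_adjP T).
- by exists `|T|; apply: op_bound_adjoint (bop_adjP T) (bop_bound T).
- by exists (bop_val T); apply: is_hadjoint_sym (bop_adjP T).
Qed.

Definition bop_star T : bop := BOp (bop_star_subproof T).

Lemma bop_starP T : is_hadjoint (bop_val T) (bop_val (bop_star T)).
Proof. exact: bop_adjP. Qed.

Lemma bop_star_uniq T S : is_hadjoint (bop_val T) (bop_val S) -> bop_star T = S.
Proof. by move=> TS; apply/val_inj/is_hadjoint_uniq/TS/bop_starP. Qed.

Lemma bop_starK : involutive bop_star.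
Proof. by move=> T; apply/bop_star_uniq/is_hadjoint_sym/bop_starP. Qed.

Lemma bop_starD S T : bop_star (S + T) = bop_star S + bop_star T.
Proof.
apply: bop_star_uniq => x y; rewrite !bop_valD !fctE linearDl linearDr /=.
by rewrite !bop_starP.
Qed.

Lemma bop_starZ (l : R[i]) T : bop_star (l *: T) = Num.conj l *: bop_star T.
Proof.
apply: bop_star_uniq => x y; rewrite !bop_valZ !fctE linearZl_LR linearZr_LR /=.
by rewrite bop_starP conjCK.
Qed.

Lemma bop_norm_star T : `|bop_star T| = `|T|.
Proof.
suff le_star S : `|bop_star S| <= `|S|.
  by apply/eqP; rewrite eq_le le_star -{1}(bop_starK T) le_star.
apply: bop_norm_min; exact: op_bound_adjoint (bop_starP S) (bop_bound S).
Qed.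

Fact bop_mul_subproof S T : bop_val S \o bop_val T \in bop_mem.
Proof.
apply/bop_memP; split=> [l x y /=||]; first by rewrite !bop_linear.
- by exists (`|S| * `|T|); apply: op_bound_comp; exact: bop_bound.
- exists (bop_val (bop_star T) \o bop_val (bop_star S)) => x y /=.
  by rewrite !bop_starP.
Qed.

Definition bop_mul S T : bop := BOp (bop_mul_subproof S T).

Fact bop_mulA : associative bop_mul.
Proof. by move=> *; exact: val_inj. Qed.

Fact bop_mulDl S T U : bop_mul (S + T) U = bop_mul S U + bop_mul T U.
Proof. exact: val_inj. Qed.

Fact bop_mulDr S T U : bop_mul S (T + U) = bop_mul S T + bop_mul S U.
Proof.
apply/val_inj/funext => x /=; rewrite !fctE.
by rewrite -[bop_val T x]scale1r bop_linear !scale1r.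
Qed.

Fact bop_mulZl (l : R[i]) S T : bop_mul (l *: S) T = l *: bop_mul S T.
Proof. exact: val_inj. Qed.

Fact bop_mulZr (l : R[i]) S T : bop_mul S (l *: T) = l *: bop_mul S T.
Proof.
apply/val_inj/funext => x /=; rewrite !fctE -[_ *: bop_val T x]addr0 bop_linear.
rewrite (_ : bop_val S 0 = 0) ?addr0 //.
by have := bop_linear S (-1) 0 0; rewrite scaler0 addr0 scaleN1r addNr.
Qed.

Fact bop_starM S T : bop_star (bop_mul S T) = bop_mul (bop_star T) (bop_star S).
Proof. by apply: bop_star_uniq => x y /=; rewrite !bop_starP. Qed.

Fact bop_normM S T : `|bop_mul S T| <= `|S| * `|T|.
Proof. by apply: bop_norm_min; apply: op_bound_comp; exact: bop_bound. Qed.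

(** For the nontrivial inequality, [|T x|^2 = <x, T^* T x> <= |T^* T| |x|^2], so the square root of
    [|T^* T|] is a bound for [T]. *)
Fact bop_cstar_identity T : `|bop_mul (bop_star T) T| = `|T| ^+ 2.
Proof.
apply/eqP; rewrite eq_le (le_trans (bop_normM _ _)) ?bop_norm_star ?expr2 //=.
rewrite -expr2 -[leRHS]sqrtCK ler_sqr ?nnegrE ?sqrtC_ge0 //.
apply: bop_norm_min; split=> [|x]; first by rewrite sqrtC_ge0.
rewrite -ler_sqr ?nnegrE ?mulr_ge0 ?sqrtC_ge0 // exprMn sqrtCK hdot_norm bop_starP.
rewrite -[hdot _ _]ger0_norm; last by rewrite -bop_starP -hdot_norm exprn_ge0.
rewrite (le_trans (cauchy_schwarz_hdot _ _)) // mulrC expr2 mulrA ler_wpM2r //.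
exact: (bop_normP (bop_mul (bop_star T) T)).
Qed.

(** The operators and their adjoints converge pointwise to [L] and [Ls]. These limits are adjoint to
    each other, which also makes [L] linear; the Cauchy condition then upgrades pointwise to norm
    convergence. *)
Fact bop_complete (F : set_system bop) : ProperFilter F -> cauchy F -> cvg F.
Proof.
move=> FF /cauchy_ballP Fc.
have Fclose e : 0 < e ->
    exists2 A, F A & forall S T, A S -> A T -> `|S - T| <= e.
  move=> e0; have [[B1 B2] /= [FB1 FB2] sub] := Fc _ e0.
  exists (B1 `&` B2) => [|S T [B1S _] [_ B2T]]; first exact: filterI.
  by have := sub (S, T) (conj B1S B2T); rewrite -ball_normE => /ltW.
have meet A B : F A -> F B -> exists T, A T /\ B T.
  by move=> FA FB; apply: (@filter_ex _ F _ (A `&` B)); apply: filterI.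
(* To be used with [h] the identity and with [h = bop_star]; a map that does not increase distances
   preserves the Cauchy property. *)
have pointwise (h : bop -> bop) x : (forall S T, `|h S - h T| <= `|S - T|) ->
    exists l, forall e, 0 < e -> F [set T | `|bop_val (h T) x - l| <= e].
  move=> hle; pose G := (fun T => bop_val (h T) x) @ F.
  have Gc : cauchy G.
    apply/cauchy_ballP => e e0.
    have x1 : 0 < `|x| + 1 by rewrite ltr_wpDl.
    have [A FA Ae] := Fclose _ (divr_gt0 e0 x1).
    pose B := (fun T => bop_val (h T) x) @` A.
    have GB : G B by apply: (@filterS _ F _ A _ _ FA) => T AT; exists T.
    exists (B, B) => // -[_ _] /= [[S AS <-] [T AT <-]]; rewrite -ball_normE /=.
    have := le_trans (hle S T) (Ae S T AS AT); rewrite ler_pdivlMr // => ST.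
    rewrite -[_ - _]/(bop_val (h S - h T) x) (le_lt_trans (bop_normP _ _)) //.
    have [->|hST] := eqVneq `|h S - h T| 0; first by rewrite mul0r.
    by rewrite (lt_le_trans _ ST) // ltr_pM2l ?ltrDl // lt_def hST /=.
  have /cvg_ex[l /cvgrPdist_le Gl] : cvg G by exact: cauchy_cvg.
  exists l => e /Gl; apply: filterS => T; by rewrite distrC.
have [L HL] := choice (fun x => pointwise id x (fun _ _ => lexx _)).
have star_le S T : `|bop_star S - bop_star T| <= `|S - T|.
  have -> : bop_star S - bop_star T = bop_star (S - T).
    by rewrite -[- T]scaleN1r bop_starD bop_starZ rmorphN1 scaleN1r.
  by rewrite bop_norm_star.
have [Ls HLs] := choice (fun x => pointwise bop_star x star_le).
have near_lim x y e : 0 < e -> exists T : bop,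
    [/\ `|bop_val T x - L x| <= e & `|bop_val (bop_star T) y - Ls y| <= e].
  move=> e0; have [T [? ?]] := meet _ _ (HL x e e0) (HLs y e e0).
  by exists T; split.
have adj : is_hadjoint L Ls.
  move=> x y; apply/eqP; rewrite -subr_eq0 -normr_le0.
  apply/ler_addgt0Pr => e e0; rewrite add0r.
  have xy1 : 0 < `|x| + `|y| + 1 by rewrite ltr_wpDl ?addr_ge0.
  have [T [Tx Ty]] := near_lim x y _ (divr_gt0 e0 xy1).
  (* The terms [<T x, y>] and [<x, T^* y>] cancel. By Cauchy-Schwarz the rest is at most
     [(|x| + |y|) e / (|x| + |y| + 1)]. *)
  have -> : hdot (L x) y - hdot x (Ls y) =
      hdot x (bop_val (bop_star T) y - Ls y) - hdot (bop_val T x - L x) y.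
    by rewrite linearBr linearBl /= bop_starP; ring.
  rewrite (le_trans (ler_normB _ _)) //.
  have CS := lerD (cauchy_schwarz_hdot x (bop_val (bop_star T) y - Ls y))
                  (cauchy_schwarz_hdot (bop_val T x - L x) y).
  rewrite (le_trans CS) // (@le_trans _ _ ((`|x| + `|y|) * (e / (`|x| + `|y| + 1)))) //.
    by rewrite mulrDl lerD // ?ler_wpM2l // mulrC ler_wpM2l.
  by rewrite mulrCA ler_piMr ?(ltW e0) // ler_pdivrMr // mul1r lerDl.
(* Members of [A] are within [e] of each other. For each [x], some [S] in [A] has [S x] within [d]
   of [L x]; letting [d] tend to 0 leaves an estimate where [T] does not depend on [x]. *)
have unif e : 0 < e -> F [set T | forall x, `|L x - bop_val T x| <= e * `|x|].
  move=> e0; have [A FA Ae] := Fclose e e0; apply: (@filterS _ F _ A _ _ FA).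
  move=> T AT x; apply/ler_addgt0Pr => d d0.
  have [S [AS LS]] := meet _ _ FA (HL x d d0).
  rewrite -(subrK (bop_val S x) (L x)) -addrA addrC (le_trans (ler_normD _ _)) //.
  rewrite lerD 1?[`|L x - _|]distrC // (le_trans (bop_normP (S - T) x)) //.
  by rewrite ler_wpM2r // Ae.
have LB : L \in bop_mem.
  apply/bop_memP; split; last by exists Ls.
    exact: is_hadjoint_linear (is_hadjoint_sym adj).
  have [T TL] := filter_ex (unif 1 ltr01).
  exists (`|T| + 1); split=> [|x]; first by rewrite addr_ge0.
  rewrite -(subrK (bop_val T x) (L x)) addrC mulrDl (le_trans (ler_normD _ _)) //.
  by rewrite lerD // bop_normP.
apply/cvg_ex; exists (BOp LB); apply/cvgrPdist_le => e e0.
apply: filterS (unif e e0) => T TL.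
by apply: bop_norm_min; split=> [|x]; [exact: ltW|exact: TL].
Qed.
HB.instance Definition _ := Uniform_isComplete.Build bop bop_complete.

HB.instance Definition _ := CompleteNormedModule_isCStar.Build R bop
  bop_mulA bop_mulDl bop_mulDr bop_mulZl bop_mulZr bop_starD bop_starZ bop_starM
  bop_starK bop_normM bop_cstar_identity.

End BoundedOperators.

(** * Hilbert space representations as homomorphisms into [bop H], and back *)

Section Representations.
Variables (R : realType) (B : cstarType R) (H : hilbertType R).

Fact rep_bop_subproof (pi : hilbertRep B H) b : pi b \in @bop_mem R H.
Proof.
apply/bop_memP; have /is_bounded_opP[pil pib] := hrep_bounded pi b.
by split=> //; exists (pi (cstar b)); exact: hrepS.
Qed.

Definition rep_bop (pi : hilbertRep B H) b : bop H :=
  BOp (rep_bop_subproof pi b).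

Fact rep_bop_linear pi : linear (rep_bop pi).
Proof. by move=> l a b; apply/val_inj/funext => x; exact: hrepP. Qed.

Fact rep_bopM pi a b : rep_bop pi (a ** b) = rep_bop pi a ** rep_bop pi b.
Proof. by apply/val_inj/funext => x; exact: hrepM. Qed.

Fact rep_bopS pi a : rep_bop pi (cstar a) = cstar (rep_bop pi a).
Proof. by apply/esym/bop_star_uniq; exact: hrepS. Qed.

Definition starHom_of_rep (pi : hilbertRep B H) : starHom B (bop H) :=
  StarHom (rep_bop_linear pi) (rep_bopM pi) (rep_bopS pi).

Variable rho : starHom B (bop H).

Fact bop_rep_bounded b : is_bounded_op (bop_val (rho b)).
Proof.
apply/is_bounded_opP; split; first exact: bop_linear.
by exists `|rho b|; exact: bop_bound.
Qed.

Fact bop_repP (l : R[i]) a b x :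
  bop_val (rho (l *: a + b)) x = l *: bop_val (rho a) x + bop_val (rho b) x.
Proof. by rewrite (star_homP rho) bop_valD bop_valZ. Qed.

Fact bop_repM a b x :
  bop_val (rho (a ** b)) x = bop_val (rho a) (bop_val (rho b) x).
Proof. by rewrite star_homM. Qed.

Fact bop_repS a : is_hadjoint (bop_val (rho a)) (bop_val (rho (cstar a))).
Proof. by rewrite star_homS; exact: bop_starP. Qed.

Definition rep_of_starHom : hilbertRep B H :=
  HilbertRep bop_rep_bounded bop_repP bop_repM bop_repS.

End Representations.

(** * Fixed points of bounded maps, and non-degenerate representations *)

Lemma closed_fixed (K : numFieldType) (V : normedModType K) (f : V -> V)
    (M : K) :
  {morph f : x y / x - y} -> 0 <= M -> (forall x, `|f x| <= M * `|x|) ->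
  closed [set x | f x = x].
Proof.
move=> fB M0 fM x clx; apply/eqP; rewrite -subr_eq0 -normr_le0.
apply/ler_addgt0Pr => e e0; rewrite add0r.
have M1 : 0 < M + 1 by rewrite ltr_wpDl.
have [y [/= fy]] := clx _ (nbhsx_ballx x _ (divr_gt0 e0 M1)).
rewrite -ball_normE /= ltr_pdivlMr // => xy.
(* With [y] a fixed point, the defect of [x] has norm at most [(M + 1) |x - y|]. *)
have -> : f x - x = f (x - y) - (x - y) by rewrite fB fy opprB addrA subrK.
rewrite (le_trans (ler_normB _ _)) // (le_trans _ (ltW xy)) //.
by rewrite mulrDr mulr1 lerD // mulrC.
Qed.

(** [pi(1)] fixes every [pi(a) y], hence their finite sums, hence the closure of these, which is all
    of [H]. *)
Lemma nondegenerate_cone (R : realType) (A : unitalCstarType R)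
    (H : hilbertType R) (pi : hilbertRep A H) :
  Defs.nondegenerate pi -> forall x, pi cone x = x.
Proof.
move=> nd x; have /is_bounded_opP[pil [M [M0 piM]]] := @hrep_bounded R A H pi cone.
pose f : {linear H -> H} := HB.pack (pi cone) (GRing.isLinear.Build _ _ _ _ _ pil).
apply: (@closed_fixed _ _ (pi cone) M (raddfB f) M0 piM).
have : closure [set v : H | exists n (a : 'I_n -> A) (x : 'I_n -> H),
                         v = \sum_(i < n) pi (a i) (x i)] x by rewrite nd.
apply: closure_subset => _ [n [a [y ->]]] /=.
rewrite -[pi cone _]/(f _) raddf_sum; apply: eq_bigr => i _ /=.
by rewrite -hrepM cone_mull.
Qed.

(** * Stacey's axioms for the relative Cuntz-Pimsner algebra *)

Section CuntzPimsnerStacey.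
Variables (R : realType) (A : unitalCstarType R) (alpha : starHom A A).
Variables (O : cstarType R) (k : corrRep (corr alpha) O).
Hypothesis hk : is_relative_cuntz_pimsner (full_ideal alpha) k.
Local Notation v := (crep_lin k (corr_gen alpha)).
Local Notation e := (crep_hom k cone).

(** The elements on which [e] acts as a two-sided unit form a C*-subalgebra containing the
    generators, so they are all of [O]. *)
Lemma cuntz_pimsner_unity : is_unity e.
Proof.
have closed_fixed_mul (f : O -> O) : (forall b, `|f b| <= `|e| * `|b|) ->
    {morph f : b c / b + c} -> (forall l b, f (l *: b) = l *: f b) ->
    closed [set b | f b = b].
  move=> fb fD fZ; apply: (closed_fixed _ (normr_ge0 e) fb) => b c.
  by rewrite fD -[- c]scaleN1r fZ scaleN1r.
have es : cstar e = e by rewrite -star_homS cstar_cone.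
pose S := [set b : O | e ** b = b] `&` [set b | b ** e = b].
suff ST : S = setT by move=> b; have : S b by rewrite ST.
apply: (rcp_generated hk); last first.
  move=> _ [[a _ <-]|[x _ <-]]; split=> /=.
  - by rewrite -star_homM cone_mull.
  - by rewrite -star_homM cone_mulr.
  - by rewrite -crep_lact; congr crep_lin; apply: val_inj; rewrite /= cproj_val.
  - by rewrite -crep_ract; congr crep_lin; apply: val_inj; rewrite /= cone_mulr.
split.
- apply: closedI; apply: closed_fixed_mul.
  + by move=> b; exact: cnormM.
  + by move=> b c; exact: cmulDr.
  + by move=> l b; exact: cmulZr.
  + by move=> b; rewrite mulrC; exact: cnormM.
  + by move=> b c; exact: cmulDl.
  + by move=> l b; exact: cmulZl.
- by split; rewrite /= -(scale0r 0) ?cmulZr ?cmulZl !scale0r.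
- by move=> a b [/= ea ae] [/= eb be]; split; rewrite /= ?cmulDr ?cmulDl ?ea ?eb ?ae ?be.
- by move=> l a [/= ea ae]; split; rewrite /= ?cmulZr ?cmulZl ?ea ?ae.
- by move=> a b [/= ea ae] [/= eb be]; split; rewrite /= ?cmulA ?ea // -cmulA be.
(* As [e] is self-adjoint, taking adjoints exchanges the left and right conditions. *)
- by move=> a [/= ea ae]; split; rewrite /= -[in LHS]es -cstarM ?ea ?ae.
Qed.

(** * The representation of [O] attached to a pair [(pi, T)] *)

Section Universal.
Variables (H : hilbertType R) (pi : hilbertRep A H) (T Ts : H -> H).
Hypotheses (pi_nd : Defs.nondegenerate pi) (Tb : is_bounded_op T).
Hypotheses (TTs : is_hadjoint T Ts) (TsT : forall x, Ts (T x) = x).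
Hypothesis piT : forall a x, pi (alpha a) x = T (pi a (Ts x)).

Fact isometry_bop_subproof : T \in @bop_mem R H.
Proof.
by apply/bop_memP; have /is_bounded_opP[Tl TM] := Tb; split=> //; exists Ts.
Qed.
Let U : bop H := BOp isometry_bop_subproof.
Let P := starHom_of_rep pi.

Let UsE x : bop_val (cstar U) x = Ts x.
Proof. by congr (_ x); exact: is_hadjoint_uniq (bop_starP U) TTs. Qed.

Let UsU : cstar U ** U = P cone.
Proof.
apply/val_inj/funext => x; rewrite -[LHS]/(bop_val (cstar U) (T x)) UsE TsT.
by rewrite /= nondegenerate_cone.
Qed.

Let Palpha a : P (alpha a) = U ** P a ** cstar U.
Proof.
apply/val_inj/funext => x.
by rewrite -[RHS]/(T (pi a (bop_val (cstar U) x))) UsE -piT.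
Qed.

Let UP : U ** P cone = U.
Proof. by apply/val_inj/funext => x /=; rewrite nondegenerate_cone. Qed.

Let t (x : corr alpha) : bop H := cstar U ** P (corr_val x).

Let t_linear : linear t.
Proof.
by move=> l x y; rewrite /t corr_valD corr_valZ (star_homP P) cmulDr cmulZr.
Qed.

Let t_ract x a : t (ract x a) = t x ** P a.
Proof. by rewrite /t corr_val_ract star_homM cmulA. Qed.

(** The left side is [pi(x)^* U U^* pi(y)]; here [U U^* = pi(p)] is absorbed because [p y = y]. *)
Let t_inner x y : cstar (t x) ** t y = P (hinner x y).
Proof.
rewrite /t cstarM cstarK cmulA -(cmulA _ U) hinner_corrE -[in RHS](cproj_val y).
by rewrite !(star_homM P) (star_homS P) Palpha UP [in RHS]cmulA.
Qed.

(** [U^* pi(alpha(a)) = U^* U pi(a) U^* = pi(a) U^*]; this is where [T] being an isometry enters. *)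
Let t_lact a x : t (lact a x) = P a ** t x.
Proof.
rewrite /t corr_val_lact star_homM Palpha !cmulA UsU.
by rewrite -!star_homM cone_mull.
Qed.

Let covariant_rep : corrRep (corr alpha) (bop H) :=
  CorrRep t_linear t_ract t_inner t_lact.

Let t_gen : t (corr_gen alpha) = cstar U.
Proof.
rewrite /t -[corr_val _]/(alpha cone) Palpha UP cmulA UsU -[in RHS]UP [in RHS]cstarM.
by rewrite -(star_homS P) cstar_cone.
Qed.

Lemma cuntz_pimsner_integrated :
  exists rho : hilbertRep O H,
    (forall a, rho (crep_hom k a) =1 pi a) /\ rho (cstar v) =1 T.
Proof.
have repE : crep_lin covariant_rep (corr_gen alpha) = cstar U by exact: t_gen.
have cov : covariant_on (full_ideal alpha) covariant_rep.
  (* Covariance reduces to [U^* U = pi(1)], the isometry condition on [T]. *)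
  by apply/covariant_onP; rewrite repE cstarK UsU.
have [rho [rhok rhot]] := rcp_universal hk cov.
exists (rep_of_starHom rho); split=> [a x|x]; first by rewrite /= rhok.
by rewrite -[LHS]/(bop_val (rho (cstar v)) x) star_homS rhot repE cstarK.
Qed.

End Universal.
End CuntzPimsnerStacey.

Theorem corollary4p15 (R : realType) (A : unitalCstarType R)
    (alpha : starHom A A) (O : cstarType R) (k : corrRep (corr alpha) O)
    (hk : is_relative_cuntz_pimsner (full_ideal alpha) k) :
  is_stacey_crossed_product alpha (crep_hom k)
    (cstar (crep_lin k (corr_gen alpha))).
Proof.
split.
- exact: cuntz_pimsner_unity.
- by rewrite cstarK; apply/covariant_onP/(rcp_covariant hk).
- by move=> a; rewrite cstarK crep_gen_implements.
- move=> S Salg sub; apply: (rcp_generated hk Salg).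
  have Sk a : S (crep_hom k a) by apply: sub; left; exists a.
  (* [t(x) = v k(x)] with [v = u^*], so a C*-subalgebra containing [k(A)] and [u] contains the
     generators of [O]. *)
  move=> _ [[a _ <-]|[x _ <-]] //; rewrite crep_linE.
  apply: (subalgM Salg) => //; rewrite -[crep_lin _ _]cstarK.
  by apply: (subalgS Salg); apply: sub; right.
- by move=> H pi T Ts; exact: cuntz_pimsner_integrated.
Qed.
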